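(* Let $\widehat{\mathbf f}_1,\widehat{\mathbf f}_2$ be numerical fluxes that are positivity-preserving with constant $C\in(0,1]$. Suppose that at time $t_n$ the piecewise polynomial approximation $\mathbf u$ satisfies, for every cell $C_{i,j}\times D_l$, $$\mathbf u(t_n,\hat x_\alpha,y_q,\hat{\boldsymbol\xi}_\rho)\in\mathcal R\qquad\text{and}\qquad \mathbf u(t_n,x_p,\hat y_\beta,\hat{\boldsymbol\xi}_\rho)\in\mathcal R$$ for all quadrature indices $\alpha,\beta\in\{0,\dots,Q_X\}$, $p,q\in\{0,\dots,Q_L\}$ and $\rho\in\mathcal P$ (point values are taken from inside the cell). Then, under the modified CFL condition $$\lambda^1_{\max}\frac{\Delta t}{\Delta x}+\lambda^2_{\max}\frac{\Delta t}{\Delta y}\le C\,\hat w_0 ,$$ where $\hat w_0$ is the first weight of the $(Q_X+1)$-point Gauss--Lobatto quadrature rule (weights normalized to sum to $1$), the cell mean $$\overline{\mathbf u}_{i,j,l}:=\frac{1}{\int_{C_{i,j}}\int_{D_l}1\, f_{D_l}\,d\boldsymbol\xi\,d(x,y)}\int_{C_{i,j}}\int_{D_l}\mathbf u\, f_{D_l}\,d\boldsymbol\xi\,d(x,y)$$ is admissible, i.e. $\overline{\mathbf u}_{i,j,l}\in\mathcal R$, after one forward Euler time step of size $\Delta t$ of the discontinuous stochastic Galerkin scheme, for every cell $C_{i,j}\times D_l$.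
   Context: **Conservation law and hyperbolicity set.** Consider $\partial_t\mathbf u+\partial_x\mathbf f_1(\mathbf u)+\partial_y\mathbf f_2(\mathbf u)=0$ with $\mathbf f_1,\mathbf f_2:\mathbb R^d\to\mathbb R^d$, where $\mathbf u=\mathbf u(t,x,y,\boldsymbol\xi)\in\mathbb R^d$ depends on time, on $(x,y)$ in a spatial domain in $\mathbb R^2$, and on an $N$-dimensional random vector $\boldsymbol\xi$ with independent components, range $\Gamma\subset\mathbb R^N$ and product probability density. The hyperbolicity set is $$\mathcal R=\Big\{\mathbf u\in\mathbb R^d:\ \alpha_1\tfrac{\partial \mathbf f_1(\mathbf u)}{\partial\mathbf u}+\alpha_2\tfrac{\partial \mathbf f_2(\mathbf u)}{\partial\mathbf u}\text{ has } d \text{ real, distinct eigenvalues for all }\alpha_1,\alpha_2\in\mathbb R,\ \alpha_1^2+\alpha_2^2=1\Big\};$$ elements of $\mathcal R$ are called admissible. Standing assumption: $\mathcal R$ is open and convex. **Mesh and approximation space.** The spatial domain is divided into a uniform rectangular mesh with cells $C_{i,j}=[x_{i-1/2},x_{i+1/2}]\times[y_{j-1/2},y_{j+1/2}]$ of widths $\Delta x,\Delta y$. The random space $\Gamma$ is divided into finitely many disjoint axis-parallel boxes $D_l$, each carrying the conditional probability density $f_{D_l}$ of $\boldsymbol\xi$ given $\boldsymbol\xi\in D_l$ (so $\int_{D_l}f_{D_l}\,d\boldsymbol\xi=1$). Fix $K_X,K_\Gamma\in\mathbb N_0$. On each $C_{i,j}\times D_l$, each component of $\mathbf u(t,\cdot)$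 belongs to $V=P_X\otimes P_\Gamma$, where $P_X=\operatorname{span}\{x^{m_1}y^{m_2}:0\le m_1,m_2\le K_X\}$ and $P_\Gamma$ is the space of polynomials in $\boldsymbol\xi$ of total degree at most $K_\Gamma$. No continuity across cells is imposed. **Quadrature.** All weights are positive and each rule is normalized so that its weights sum to $1$. In each spatial cell, $(\hat x_\alpha,\hat w_\alpha)_{\alpha=0}^{Q_X}$ and $(\hat y_\beta,\hat w_\beta)_{\beta=0}^{Q_X}$ are the one-dimensional Gauss--Lobatto rules with $Q_X+1=\lceil (K_X+1)/2\rceil+1$ points on $[x_{i-1/2},x_{i+1/2}]$ and $[y_{j-1/2},y_{j+1/2}]$ (these include both endpoints). $(x_p,w_p)_{p=0}^{Q_L}$ and $(y_q,w_q)_{q=0}^{Q_L}$ are Gauss--Legendre rules on the same intervals, of sufficient accuracy to be exact for polynomials of degree $K_X$. On $D_l$, $(\hat{\boldsymbol\xi}_\rho,\hat\omega_\rho)_{\rho\in\mathcal P}$, with $\mathcal P=\{\rho=(\rho_1,\dots,\rho_N)\in\mathbb N_0^N:\rho_i\le Q_\Gamma\}$ and $Q_\Gamma=\lceil (K_\Gamma+1)/2\rceil$, is a tensor-product rule for $\int_{D_l}g\,f_{D_l}\,d\boldsymbol\xi\approx\sum_\rho g(\hat{\boldsymbol\xi}_\rho)\hat\omega_\rho$ (Gauss--Lobatto for the uniform distribution, otherwise the Gauss rule associated with the density $f_{D_l}$); it is exact on $P_\Gamma$. **Numerical fluxes.** $\lambda^k_{\max}>0$ ($k=1,2$) is a global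 estimate (upper bound) of the absolute values of the eigenvalues of $\partial\mathbf f_k(\mathbf u)/\partial\mathbf u$ over the point values of the approximation at time $t_n$. The numerical flux $\widehat{\mathbf f}_k$ is called positivity-preserving with constant $C\in(0,1]$ if the first-order scheme in direction $k$ preserves $\mathcal R$ under its CFL condition: for all $\mathbf a,\mathbf b,\mathbf c\in\mathcal R$ at which the eigenvalues of $\partial\mathbf f_k/\partial\mathbf u$ are bounded in absolute value by $\lambda^k_{\max}$, and all $r>0$ with $\lambda^k_{\max}\,r\le C$ (where $r$ stands for time step divided by mesh width), $$\mathbf b-r\big(\widehat{\mathbf f}_k(\mathbf b,\mathbf c)-\widehat{\mathbf f}_k(\mathbf a,\mathbf b)\big)\in\mathcal R .$$ **Scheme.** Superscripts $-$ and $+$ denote one-sided limits: $x^-_{i+1/2}$ from the left, $x^+_{i+1/2}$ from the right, and similarly for $y$. The semi-discrete discontinuous stochastic Galerkin scheme requires, for every cell $C_{i,j}\times D_l$ and every test function $v\in V$, $$\frac{d}{dt}\int_{C_{i,j}}\!\int_{D_l}\mathbf u\,v\,f_{D_l}\,d\boldsymbol\xi\,d(x,y)=\mathcal Q\big[\mathbf f_1(\mathbf u)\partial_xv+\mathbf f_2(\mathbf u)\partial_yv\big]$$ $$-\Delta y\sum_{q=0}^{Q_L}\sum_{\rho\in\mathcal P}w_q\hat\omega_\rho\Big(\widehat{\mathbf F}_{i+1/2}\,v(x^-_{i+1/2},y_q,\hat{\boldsymbol\xi}_\rho)-\widehat{\mathbf F}_{i-1/2}\,v(x^+_{i-1/2},y_q,\hat{\boldsymbol\xi}_\rho)\Big)$$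 $$-\Delta x\sum_{p=0}^{Q_L}\sum_{\rho\in\mathcal P}w_p\hat\omega_\rho\Big(\widehat{\mathbf G}_{j+1/2}\,v(x_p,y^-_{j+1/2},\hat{\boldsymbol\xi}_\rho)-\widehat{\mathbf G}_{j-1/2}\,v(x_p,y^+_{j-1/2},\hat{\boldsymbol\xi}_\rho)\Big),$$ where $\mathcal Q[\cdot]$ is a (linear) quadrature approximation of the integral over $C_{i,j}\times D_l$ weighted by $f_{D_l}$, $\widehat{\mathbf F}_{i\pm1/2}=\widehat{\mathbf f}_1\big(\mathbf u(t,x^-_{i\pm1/2},y_q,\hat{\boldsymbol\xi}_\rho),\mathbf u(t,x^+_{i\pm1/2},y_q,\hat{\boldsymbol\xi}_\rho)\big)$ and $\widehat{\mathbf G}_{j\pm1/2}=\widehat{\mathbf f}_2\big(\mathbf u(t,x_p,y^-_{j\pm1/2},\hat{\boldsymbol\xi}_\rho),\mathbf u(t,x_p,y^+_{j\pm1/2},\hat{\boldsymbol\xi}_\rho)\big)$. A forward Euler step of size $\Delta t$ from $t_n$ to $t_{n+1}=t_n+\Delta t$ replaces $\frac{d}{dt}$ by the difference quotient and evaluates the right-hand side at $t_n$. At the boundary of the spatial domain, exterior traces are treated as traces of a neighbouring cell to which the hypothesis on point values also applies. *)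

(* Defs.v *)
From HB Require Import structures.
From mathcomp Require Import all_boot all_order all_algebra.
From mathcomp Require Import all_classical all_reals all_analysis.
Import numFieldNormedType.Exports.
Import Order.TTheory GRing.Theory Num.Theory.

Set Implicit Arguments.
Unset Strict Implicit.
Unset Printing Implicit Defensive.

Local Open Scope classical_set_scope.
Local Open Scope ring_scope.

(** * Hyperbolicity set and positivity-preserving fluxes *)

Section Hyperbolicity.
Context {R : realType} {d : nat}.
Implicit Types (f g : 'rV[R]_d -> 'rV[R]_d) (u : 'rV[R]_d).

Definition real_distinct_eigenvalues (A : 'M[R]_d) : Prop :=
  exists s : d.-tuple R, uniq s /\ forall e, e \in s -> eigenvalue A e.

(* States are row vectors, so ['J f u] is the transpose of the usual Jacobian
   matrix; [eigenvalue] is about left eigenvectors, and the two have the same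
   eigenvalues.  Differentiability is required because ['J f u] is total and
   is the Jacobian only where [f] is differentiable. *)
Definition hyperbolicity_set f1 f2 : set 'rV[R]_d :=
  [set u | [/\ differentiable f1 u, differentiable f2 u &
    forall a1 a2 : R, a1 ^+ 2 + a2 ^+ 2 = 1 ->
      real_distinct_eigenvalues (a1 *: 'J f1 u + a2 *: 'J f2 u)]].

(* Where it is used, at points of [hyperbolicity_set], all d eigenvalues are
   real. *)
Definition eigenvalues_bounded f (lam : R) u : Prop :=
  forall e : R, eigenvalue ('J f u) e -> `|e| <= lam.

Definition positivity_preserving (adm : set 'rV[R]_d) f (lam C : R)
    (fhat : 'rV[R]_d -> 'rV[R]_d -> 'rV[R]_d) : Prop :=
  forall (a b c : 'rV[R]_d) (r : R),
    adm a -> adm b -> adm c ->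
    eigenvalues_bounded f lam a -> eigenvalues_bounded f lam b ->
    eigenvalues_bounded f lam c ->
    0 < r -> lam * r <= C ->
    adm (b - r *: (fhat b c - fhat a b)).

End Hyperbolicity.

(** * Lebesgue measure on R^N *)

Notation rvec R N := (N.-tuple (measurableTypeR R)).

Section LebesgueTuple.
Context {R : realType}.

Definition cons_rvec n (z : measurableTypeR R * rvec R n) : rvec R n.+1 :=
  [the n.+1.-tuple (measurableTypeR R) of z.1 :: z.2].

Lemma measurable_cons_rvec n : measurable_fun setT (@cons_rvec n).
Proof. by apply: measurable_cons. Qed.

Section Step.
Variables (n : nat) (m : {sigma_finite_measure set (rvec R n) -> \bar R}).

Definition leb_step : set (rvec R n.+1) -> \bar R :=
  pushforward ((@lebesgue_measure R) \x m)%E (@cons_rvec n).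

HB.instance Definition _ := Measure.copy leb_step
  (measure_function_pushforward__canonical__measure_function_Measure
     ((@lebesgue_measure R) \x m)%E (@measurable_cons_rvec n)).

Let leb_step_sigma_finite : sigma_finite setT leb_step.
Proof.
have /sigma_finiteP[F [TF ndF Foo]] := sigma_finiteT (@lebesgue_measure R).
have /sigma_finiteP[G [TG ndG Goo]] := sigma_finiteT m.
pose split (t : rvec R n.+1) : measurableTypeR R * rvec R n :=
  (tnth t ord0, [tuple of behead t]).
have msplit : measurable_fun setT split.
  by apply: measurable_fun_pair; [exact: measurable_tnth|exact: measurable_behead].
have splitK : cancel (@cons_rvec n) split.
  by case=> x t; congr pair; apply: val_inj.
exists (fun k => split @^-1` (F k `*` G k)).
  rewrite -preimage_bigcup -[LHS](preimage_setT split); congr preimage.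
  rewrite -setXTT TF TG predeqE => -[x y]; split.
    move=> [/= [k _ Fkx] [l _ Gly]]; exists (maxn k l) => //; split.
    - by move: x Fkx; exact/subsetPset/ndF/leq_maxl.
    - by move: y Gly; exact/subsetPset/ndG/leq_maxr.
  by move=> [k _ []/= ? ?]; split; exists k.
move=> k; have [mF Fk] := Foo k; have [mG Gk] := Goo k; split.
  by rewrite -[X in measurable X]setTI; apply: msplit => //; exact: measurableX.
rewrite /leb_step /pushforward -comp_preimage.
rewrite (_ : _ \o _ = id) ?preimage_id; last by apply/funext => z; exact: splitK.
by rewrite product_measure1E// lte_mul_pinfty// ge0_fin_numE.
Qed.

HB.instance Definition _ :=
  Measure_isSigmaFinite.Build _ _ _ leb_step leb_step_sigma_finite.

End Step.

(* On the one-point space R^0 this is the unit mass. *)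
Fixpoint lebesgue_tuple n : {sigma_finite_measure set (rvec R n) -> \bar R} :=
  if n is n'.+1 then leb_step (lebesgue_tuple n')
  else \d_([tuple] : rvec R 0).

End LebesgueTuple.

(** * One-dimensional quadrature rules *)

Section Quadrature.
Context {R : realType}.
Local Notation mu := (@lebesgue_measure R).

Record rule n := Rule { node : 'I_n.+1 -> R ; weight : 'I_n.+1 -> R }.

Definition normalized_rule n (q : rule n) : Prop :=
  [/\ {homo node q : i j / (i < j)%N >-> i < j},
      forall i, 0 < weight q i
    & \sum_i weight q i = 1].

(* Exactness for polynomials of degree at most [m] against the density [f]
   on [D]; for unbounded [D] the moments involved must exist. *)
Definition exact_rule (D : set R) (f : R -> R) (m : nat) n (q : rule n) :=
  forall p : {poly R}, (size p <= m.+1)%N ->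
    mu.-integrable D (fun x => (p.[x] * f x)%:E) /\
    \int[mu]_(x in D) (p.[x] * f x) = \sum_i weight q i * p.[node q i].

(* [q] has n + 1 nodes, so the Gauss rule has degree 2n + 1 and the
   Gauss-Lobatto rule, two of whose nodes are prescribed, degree 2n - 1.
   These properties determine the rules uniquely. *)
Definition gauss_rule (D : set R) (f : R -> R) n (q : rule n) : Prop :=
  [/\ normalized_rule q, forall i, D (node q i)
    & exact_rule D f n.*2.+1 q].

Definition gauss_legendre_rule (a b : R) n (q : rule n) : Prop :=
  gauss_rule `[a, b] (uniform_pdf a b) q.

Definition gauss_lobatto_rule (a b : R) n (q : rule n) : Prop :=
  [/\ normalized_rule q, node q ord0 = a, node q ord_max = b
    & exact_rule `[a, b] (uniform_pdf a b) n.*2.-1 q].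

End Quadrature.
Arguments rule : clear implicits.

(** * Space and random space *)

(* [cells] is the set of indices of the cells of the spatial domain; the cell
   (i, j) is [x_{i-1/2}, x_{i+1/2}] x [y_{j-1/2}, y_{j+1/2}] with
   x_{i-1/2} = xorig + i dx and y_{j-1/2} = yorig + j dy. *)
Record mesh (R : realType) := Mesh {
  xorig : R; yorig : R; dx : R; dy : R;
  dx_gt0 : 0 < dx;
  dy_gt0 : 0 < dy;
  cells : set (int * int) }.

Section Mesh.
Context {R : realType} (M : mesh R).

Definition xface (i : int) : R := xorig M + i%:~R * dx M.
Definition yface (j : int) : R := yorig M + j%:~R * dy M.

Definition cell (i j : int) : set (R * R) :=
  `[xface i, xface (i + 1)] `*` `[yface j, yface (j + 1)].

(* Images in a cell of the point [t] of the reference interval [-1, 1]. *)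
Definition xnode (i : int) (t : R) : R := xface i + dx M * ((1 + t) / 2).
Definition ynode (j : int) (t : R) : R := yface j + dy M * ((1 + t) / 2).

(* The cells of the mesh together with the cells sharing a face with one of
   them, from which the exterior traces at the boundary are taken. *)
Definition extended_cells : set (int * int) :=
  [set c | cells M c \/ cells M (c.1 + 1, c.2) \/ cells M (c.1 - 1, c.2)
           \/ cells M (c.1, c.2 + 1) \/ cells M (c.1, c.2 - 1)].

End Mesh.

(* The components of the random vector are independent, the k-th one with
   density [marginal k], so the joint density is the product; its range is
   divided into the boxes D_l = prod_k [box l k]. *)
Definition joint_density (R : realType) N (marginal : 'I_N -> R -> R)
  (xi : rvec R N) : R := \prod_k marginal k (tnth xi k).

Definition box_set (R : realType) N (b : 'I_N -> interval R) : set (rvec R N) :=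
  [set xi | forall k, tnth xi k \in b k].

Record random_space (R : realType) (N L : nat) := RandomSpace {
  marginal : 'I_N -> R -> R;
  Gamma : set (rvec R N);
  box : 'I_L -> 'I_N -> interval R;
  marginal_measurable : forall k, measurable_fun setT (marginal k);
  marginal_ge0 : forall k x, 0 <= marginal k x;
  marginal_int1 :
    forall k, (\int[@lebesgue_measure R]_x (marginal k x)%:E = 1)%E;
  Gamma_full : (\int[lebesgue_tuple N]_(xi in Gamma)
                  (joint_density marginal xi)%:E = 1)%E;
  Gamma_boxes : Gamma = \bigcup_l box_set (box l);
  boxes_disjoint : trivIset setT (fun l => box_set (box l));
  boxes_gt0 : forall l, (0 < \int[lebesgue_tuple N]_(xi in box_set (box l))
                               (joint_density marginal xi)%:E)%E }.

Section RandomSpace.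
Context {R : realType} {N L : nat} (S : random_space R N L).

Definition cell_density (l : 'I_L) (xi : rvec R N) : R :=
  joint_density (marginal S) xi /
  \int[lebesgue_tuple N]_(z in box_set (box S l)) joint_density (marginal S) z.

Definition cell_marginal (l : 'I_L) (k : 'I_N) (x : R) : R :=
  marginal S k x /
  \int[@lebesgue_measure R]_(z in [set` box S l k]) marginal S k z.

(* The rule in the k-th direction of D_l: the Gauss-Lobatto rule may be used
   when the conditional distribution of the k-th component is uniform, the
   Gauss rule for the conditional density in all cases. *)
Definition random_rule n (l : 'I_L) (k : 'I_N) (q : rule R n) : Prop :=
  (exists (a b : R) (ba bb : bool),
    [/\ a < b, box S l k = Interval (BSide ba a) (BSide bb b),
      {ae @lebesgue_measure R, forall x, x \in box S l k ->
         cell_marginal l k x = uniform_pdf a b x}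
    & gauss_lobatto_rule a b q]) \/
  gauss_rule [set` box S l k] (cell_marginal l k) q.

End RandomSpace.

(** * Discontinuous stochastic Galerkin scheme *)

(* P_X (x) P_Gamma: degree at most [KX] in each of x and y, total degree at
   most [KG] in xi. *)
Definition dsg_space (R : realType) (N KX KG : nat) :
    set (R -> R -> rvec R N -> R) :=
  [set g | exists c : 'I_KX.+1 -> 'I_KX.+1 -> {ffun 'I_N -> 'I_KG.+1} -> R,
    forall x y xi, g x y xi =
      \sum_(m1 < KX.+1) \sum_(m2 < KX.+1)
      \sum_(m : {ffun 'I_N -> 'I_KG.+1} | (\sum_k m k <= KG)%N)
        c m1 m2 m * x ^+ m1 * y ^+ m2 * \prod_k tnth xi k ^+ m k].

Section Scheme.
Context {R : realType} {d N L : nat} (KX KG : nat) {QL : nat}.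
Variables (M : mesh R) (S : random_space R N L).

(* Gauss-Lobatto and Gauss-Legendre rules on [-1, 1], and the rules on the
   sides of the boxes D_l; the numbers of nodes are Q_X + 1, Q_L + 1 and
   Q_Gamma + 1 with Q_X = ceil((K_X + 1) / 2), Q_Gamma = ceil((K_Gamma + 1) / 2). *)
Variables (gl : rule R (uphalf KX.+1)) (lg : rule R QL)
  (rq : 'I_L -> 'I_N -> rule R (uphalf KG.+1)).

Local Notation mu := (@lebesgue_measure R).
Local Notation state := 'rV[R]_d.
Local Notation multi_index := {ffun 'I_N -> 'I_(uphalf KG.+1).+1}.

(* A piecewise polynomial is given by its polynomial on each cell, so that
   one-sided limits at a face are values of the polynomial of the
   corresponding cell. *)
Local Notation approximation := (int -> int -> 'I_L -> R -> R -> rvec R N -> state).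

Definition rnode (l : 'I_L) (rho : multi_index) : rvec R N :=
  [tuple node (rq l k) (rho k) | k < N].

Definition rweight (l : 'I_L) (rho : multi_index) : R :=
  \prod_k weight (rq l k) (rho k).

Definition approximation_space : set approximation :=
  [set u | forall i j l c, cells M (i, j) ->
    dsg_space KX KG (fun x y xi => u i j l x y xi 0 c)].

Definition point_values (u : approximation) (i j : int) (l : 'I_L) : set state :=
  [set v |
    (exists a q rho,
      v = u i j l (xnode M i (node gl a)) (ynode M j (node lg q)) (rnode l rho))
    \/
    (exists p b rho,
      v = u i j l (xnode M i (node lg p)) (ynode M j (node gl b)) (rnode l rho))].

Definition cell_integral (i j : int) (l : 'I_L) (g : R -> R -> rvec R N -> R) : R :=
  \int[(mu \x mu)%E]_(z in cell M i j)
    \int[lebesgue_tuple N]_(xi in box_set (box S l))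
      (g z.1 z.2 xi * cell_density S l xi).

Definition cell_integralv (i j : int) (l : 'I_L) (g : R -> R -> rvec R N -> state) :
    state :=
  \row_c cell_integral i j l (fun x y xi => g x y xi 0 c).

Definition cell_mean (u : approximation) (i j : int) (l : 'I_L) : state :=
  (cell_integral i j l (fun _ _ _ => 1))^-1 *: cell_integralv i j l (u i j l).

Variables (f1 f2 : state -> state) (fhat1 fhat2 : state -> state -> state).

(* Numerical fluxes at x_{i-1/2} and y_{j-1/2}. *)
Definition xflux (u : approximation) (i j : int) l (q : 'I_QL.+1) rho : state :=
  let y := ynode M j (node lg q) in let xi := rnode l rho in
  fhat1 (u (i - 1) j l (xface M i) y xi) (u i j l (xface M i) y xi).

Definition yflux (u : approximation) (i j : int) l (p : 'I_QL.+1) rho : state :=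
  let x := xnode M i (node lg p) in let xi := rnode l rho in
  fhat2 (u i (j - 1) l x (yface M j) xi) (u i j l x (yface M j) xi).

(* [Q i j l] stands for the quadrature of the volume term over the cell
   (i, j) x D_l; any functional linear in the integrand is allowed. *)
Definition linear_quadrature
    (Q : int -> int -> 'I_L -> (R -> R -> rvec R N -> state) -> state) : Prop :=
  forall i j l (a : R) g h,
    Q i j l (fun x y xi => a *: g x y xi + h x y xi) =
    a *: Q i j l g + Q i j l h.

Definition dsg_rhs
    (Q : int -> int -> 'I_L -> (R -> R -> rvec R N -> state) -> state)
    (u : approximation) (i j : int) (l : 'I_L) (v : R -> R -> rvec R N -> R) : state :=
  Q i j l (fun x y xi =>
      derive1 (fun s : R => v s y xi) x *: f1 (u i j l x y xi) +
      derive1 (fun s : R => v x s xi) y *: f2 (u i j l x y xi))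
  - dy M *: (\sum_q \sum_rho (weight lg q * rweight l rho) *:
      (v (xface M (i + 1)) (ynode M j (node lg q)) (rnode l rho) *:
         xflux u (i + 1) j l q rho
       - v (xface M i) (ynode M j (node lg q)) (rnode l rho) *:
         xflux u i j l q rho))
  - dx M *: (\sum_p \sum_rho (weight lg p * rweight l rho) *:
      (v (xnode M i (node lg p)) (yface M (j + 1)) (rnode l rho) *:
         yflux u i (j + 1) l p rho
       - v (xnode M i (node lg p)) (yface M j) (rnode l rho) *:
         yflux u i j l p rho)).

Definition euler_step
    (Q : int -> int -> 'I_L -> (R -> R -> rvec R N -> state) -> state)
    (dt : R) (u unew : approximation) : Prop :=
  forall i j l v, cells M (i, j) -> dsg_space KX KG v ->
    dt^-1 *: (cell_integralv i j l (fun x y xi => v x y xi *: unew i j l x y xi)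
              - cell_integralv i j l (fun x y xi => v x y xi *: u i j l x y xi))
    = dsg_rhs Q u i j l v.

End Scheme.

(* Main.v *)
Require Import Defs.
From mathcomp Require Import all_boot all_order all_algebra.
From mathcomp Require Import all_classical all_reals all_analysis.
From mathcomp Require Import measurable_realfun.
From mathcomp Require Import ring lra zify.
Import numFieldNormedType.Exports.
Import Order.TTheory GRing.Theory Num.Theory.

Set Implicit Arguments.
Unset Strict Implicit.
Unset Printing Implicit Defensive.

Local Open Scope classical_set_scope.
Local Open Scope ring_scope.

(** The argument is that of Zhang and Shu: the new cell mean is a convex
combination of results of first-order updates of admissible states, and of
admissible states themselves.

Testing the scheme with v = 1 removes the volume term, so the new cell mean is
the old one minus flux differences ([euler_cell_mean]). The old mean equals a
quadrature sum of point values, because all rules are exact on the approximation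
space ([cell_mean_exact]), and there are two ways to write it: with
Gauss-Lobatto nodes in x and Gauss-Legendre nodes in y, or with the roles
exchanged. The first expression is taken with the share s of the x-direction in
the total CFL number and combined with the x-fluxes, the second is taken with
the share 1 - s and combined with the y-fluxes.

For a fixed Gauss-Legendre node and a fixed random node, this leaves an average
of states along a line of Gauss-Lobatto nodes minus a difference of two fluxes.
The first and the last node are the endpoints of the line; inserting the flux
between these two end states splits the difference into two first-order updates,
one for each end node, and the positivity of the numerical flux applies
([line_update_admissible]). It needs the two end weights to be equal, which is
deduced from the degree of exactness alone ([lobatto_weight_sym]).

Exactness over a cell rests on Fubini's theorem for products of functions of one
variable ([integral_is_tuple]) and, in space, on the fact that exactness on the
reference interval is an identity between values of primitives, hence is carried
over by affine maps ([rule_affine]). *)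

(** * Integrals of products of one-variable functions *)

(** Integrability is part of the assertion because the real-valued integral is
    a total function, additive only on integrable functions. *)
Definition integral_is {R : realType} {di} {T : measurableType di}
    (mu : {measure set T -> \bar R}) (D : set T) (f : T -> R) (v : R) : Prop :=
  mu.-integrable D (EFin \o f) /\ \int[mu]_(x in D) f x = v.

Section IntegralIs.
Context {R : realType} di (T : measurableType di)
  (mu : {measure set T -> \bar R}).
Implicit Types (D : set T) (f g : T -> R) (v w : R).

Lemma eq_integral_is D f g v :
  measurable D -> {in D, f =1 g} ->
  integral_is mu D f v -> integral_is mu D g v.
Proof.
move=> mD fg [fi fv]; split.
  by apply: eq_integrable fi => // x xD /=; rewrite fg.
by rewrite -fv; apply: eq_Rintegral => x xD; rewrite fg.
Qed.

Lemma integral_is_restrict D f v : measurable D ->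
  integral_is mu D f v <-> integral_is mu setT (f \_ D) v.
Proof.
move=> mD; rewrite /integral_is -Rintegral_mkcond (integrable_mkcond _ mD).
by rewrite restrict_EFin.
Qed.

Lemma integral_is_EFin D f v : measurable D ->
  integral_is mu D f v -> (\int[mu]_(x in D) (f x)%:E = v%:E)%E.
Proof.
by move=> mD [fi <-]; rewrite /Rintegral fineK//; exact: integrable_fin_num fi.
Qed.

Lemma integral_is_fine D f v : mu.-integrable D (EFin \o f) ->
  (\int[mu]_(x in D) (f x)%:E = v%:E)%E -> integral_is mu D f v.
Proof. by move=> fi fv; split => //; rewrite /Rintegral fv. Qed.

Lemma integral_isZ D f v (k : R) : measurable D ->
  integral_is mu D f v -> integral_is mu D (fun x => k * f x) (k * v).
Proof.
move=> mD [fi <-]; split; last exact: RintegralZl.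
by apply: eq_integrable (integrableZl mD k fi).
Qed.

Lemma integral_is_sum D (I : Type) (s : seq I) (P : pred I) (F : I -> T -> R)
    (V : I -> R) : measurable D ->
  (forall i, P i -> integral_is mu D (F i) (V i)) ->
  integral_is mu D (fun x => \sum_(i <- s | P i) F i x)
    (\sum_(i <- s | P i) V i).
Proof.
move=> mD FV; elim: s => [|i s [IHi IHv]].
  apply: (@eq_integral_is _ (cst 0)) => // [x _|]; first by rewrite big_nil.
  rewrite big_nil; split; first exact: integrable0.
  by rewrite /Rintegral integral0_eq.
have [Pi|Pi] := boolP (P i); last first.
  rewrite big_cons (negbTE Pi); apply: eq_integral_is (conj IHi IHv) => // x _.
  by rewrite big_cons (negbTE Pi).
have [Fi Fv] := FV _ Pi.
apply: (@eq_integral_is _ (fun x => F i x + \sum_(j <- s | P j) F j x)).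
- by [].
- by move=> x _; rewrite big_cons Pi.
split; first by apply: eq_integrable (integrableD mD Fi IHi).
by rewrite RintegralD// Fv IHv big_cons Pi.
Qed.

Lemma ae_integral_is f g v : measurable_fun setT g ->
  {ae mu, forall x, f x = g x} ->
  integral_is mu setT f v -> integral_is mu setT g v.
Proof.
move=> mg fg fv; have [fi _] := fv.
have mf : measurable_fun setT f by exact/measurable_EFinP/(measurable_int mu).
apply: integral_is_fine.
  apply/integrableP; split; first exact/measurable_EFinP.
  have /integrableP[_] := fi.
  rewrite (@ae_eq_integral _ _ _ mu setT (abse \o EFin \o g)
    (abse \o EFin \o f))//.
  - by apply: measurableT_comp => //; exact/measurable_EFinP.
  - by apply: measurableT_comp => //; exact/measurable_EFinP.
  - by apply: filterS fg => x fgx _ /=; rewrite fgx.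
rewrite -(integral_is_EFin measurableT fv); apply: ae_eq_integral => //.
- exact/measurable_EFinP.
- exact/measurable_EFinP.
- by apply: filterS fg => x fgx _ /=; rewrite fgx.
Qed.

End IntegralIs.

Section Product.
Context {R : realType} d1 d2 (T1 : measurableType d1) (T2 : measurableType d2).
Variables (m1 : {sigma_finite_measure set T1 -> \bar R}).
Variables (m2 : {sigma_finite_measure set T2 -> \bar R}).

Let integral_is_prodT (f : T1 -> R) (g : T2 -> R) (v w : R) :
  integral_is m1 setT f v -> integral_is m2 setT g w ->
  integral_is (m1 \x m2)%E setT (fun z => f z.1 * g z.2) (v * w).
Proof.
move=> fv gw; have [fi _] := fv; have [gi _] := gw.
have mf : measurable_fun setT f by exact/measurable_EFinP/(measurable_int m1).
have mg : measurable_fun setT g by exact/measurable_EFinP/(measurable_int m2).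
have mfg : measurable_fun setT (EFin \o (fun z : T1 * T2 => f z.1 * g z.2)).
  by apply/measurable_EFinP/measurable_funM; exact: measurableT_comp.
have ni : m2.-integrable setT (EFin \o (Num.norm \o g)).
  exact: integrable_norm.
have fgi : (m1 \x m2)%E.-integrable setT
    (EFin \o (fun z : T1 * T2 => f z.1 * g z.2)).
  apply/integrable12ltyP => //=.
  have nf : m1.-integrable setT (EFin \o (Num.norm \o f)).
    exact: integrable_norm.
  pose C := \int[m2]_y `|g y|.
  under eq_integral => x _.
    under eq_integral => y _ do rewrite normrM EFinM.
    rewrite integralZl// (_ : (\int[m2]_y _ = C%:E)%E); last first.
      exact: (integral_is_EFin measurableT (conj ni erefl)).
    over.
  rewrite integralZr//.
  by rewrite (integral_is_EFin measurableT (conj nf erefl)) -EFinM ltry.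
apply: integral_is_fine => //.
rewrite -integral12_prod_meas1//= /fubini_F.
under eq_integral => x _.
  under eq_integral => y _ do rewrite /= EFinM.
  rewrite integralZl// (integral_is_EFin measurableT gw).
  over.
by rewrite integralZr// (integral_is_EFin measurableT fv) EFinM.
Qed.

(** Fubini's theorem for f(x) g(y): extending both factors by 0 outside [A] and
    [B] reduces the claim to the whole product space. *)
Lemma integral_is_prod (A : set T1) (B : set T2) (f : T1 -> R) (g : T2 -> R)
    (v w : R) : measurable A -> measurable B ->
  integral_is m1 A f v -> integral_is m2 B g w ->
  integral_is (m1 \x m2)%E (A `*` B) (fun z => f z.1 * g z.2) (v * w).
Proof.
move=> mA mB /(integral_is_restrict _ _ _ mA) fv.
move=> /(integral_is_restrict _ _ _ mB) gw.
apply/integral_is_restrict; first exact: measurableX.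
apply: eq_integral_is (integral_is_prodT fv gw) => // -[x y] _ /=.
rewrite !patchE/= in_setX/=.
by case: (x \in A); case: (y \in B); rewrite ?mul0r ?mulr0.
Qed.

End Product.

Section Tuple.
Context {R : realType}.
Local Notation mR := (measurableTypeR R).
Local Notation mu := (@lebesgue_measure R).

Definition box_of n (A : 'I_n -> set mR) : set (rvec R n) :=
  [set xi | forall k, A k (tnth xi k)].

Lemma measurable_box_of n (A : 'I_n -> set mR) :
  (forall k, measurable (A k)) -> measurable (box_of A).
Proof.
move=> mA.
rewrite (_ : box_of A =
    \big[setI/setT]_(k < n) [set xi : rvec R n | A k (tnth xi k)]).
  apply: bigsetI_measurable => k _.
  rewrite -[X in measurable X]setTI.
  exact: (@measurable_tnth _ mR n k _ _ (mA k)).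
rewrite -bigcap_seq; apply/seteqP; split => xi /= Axi k.
  by move=> _; exact: Axi.
by apply: Axi; rewrite /= mem_index_enum.
Qed.

Let integral_is_tupleT n (f : 'I_n -> mR -> R) (v : 'I_n -> R) :
  (forall k, integral_is mu setT (f k) (v k)) ->
  integral_is (lebesgue_tuple n) setT
    (fun xi => \prod_k f k (tnth xi k)) (\prod_k v k).
Proof.
elim: n f v => [|n IH] f v fv.
  rewrite big_ord0.
  apply: (@eq_integral_is _ _ _ _ _ (cst 1)) => // [xi _|].
    by rewrite big_ord0.
  apply: integral_is_fine.
    apply/integrableP; split; first exact/measurable_EFinP/measurable_cst.
    rewrite /= normr1.
    by rewrite integral_dirac//= diracT mul1e ltry.
  by rewrite integral_dirac//= diracT mul1e.
have /= H := IH _ _ (fun k => fv (lift ord0 k)).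
have := integral_is_prod measurableT measurableT (fv ord0) H.
rewrite -(big_ord_recl _ (fun k => v k)) setXTT => -[HI HV].
have mf : measurable_fun setT
    (EFin \o (fun xi : rvec R n.+1 => \prod_k f k (tnth xi k))).
  apply/measurable_EFinP; apply: measurable_prod => k _.
  apply: (measurableT_comp (f := f k)); last exact: measurable_tnth.
  by have [+ _] := fv k => /(measurable_int lebesgue_measure)/measurable_EFinP.
have consE : (EFin \o (fun z : mR * rvec R n =>
     f ord0 z.1 * \prod_k f (lift ord0 k) (tnth z.2 k))) =
    (EFin \o (fun xi : rvec R n.+1 => \prod_k f k (tnth xi k))) \o
      @cons_rvec R n.
  apply/funext => -[x t] /=; rewrite big_ord_recl; congr (_ * _)%:E.
  by apply: eq_bigr => k _; rewrite tnthS.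
have := integral_is_EFin measurableT (conj HI HV).
rewrite consE in HI => HV'.
apply: integral_is_fine.
  exact: (integrable_pushforward (@measurable_cons_rvec R n) mf HI).
rewrite -HV' [LHS](integral_pushforward (@measurable_cons_rvec R n) mf HI)//.
by apply: eq_integral => -[x t] _; have /= := congr1 (@^~ (x, t)) consE.
Qed.

(** Fubini's theorem, one coordinate at a time: [lebesgue_tuple n.+1] is the
    image of the product of the line with R^n under [cons_rvec]. *)
Lemma integral_is_tuple n (A : 'I_n -> set mR) (f : 'I_n -> mR -> R)
    (v : 'I_n -> R) : (forall k, measurable (A k)) ->
  (forall k, integral_is mu (A k) (f k) (v k)) ->
  integral_is (lebesgue_tuple n) (box_of A)
    (fun xi => \prod_k f k (tnth xi k)) (\prod_k v k).
Proof.
move=> mA fv; apply/integral_is_restrict; first exact: measurable_box_of.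
have fvT (k : 'I_n) : integral_is mu setT ((f k) \_ (A k)) (v k).
  exact/(integral_is_restrict _ _ _ (mA k)).
apply: eq_integral_is (integral_is_tupleT fvT) => // xi _.
rewrite patchE; have [xiA|xiA] := boolP (xi \in _).
  by apply: eq_bigr => k _; rewrite patchE mem_set//; move/set_mem: xiA; apply.
have [k Nk] : exists k, ~ A k (tnth xi k).
  by apply/existsNP; rewrite notin_setE in xiA.
by rewrite (bigD1 k)//= patchE memNset// mul0r.
Qed.

End Tuple.

(** * Quadrature on the boxes of the random space *)

Section RandomRule.
Context {R : realType} {N L : nat} (S : random_space R N L).
Local Notation mR := (measurableTypeR R).
Local Notation mu := (@lebesgue_measure R).

Lemma random_rule_normalized n l k (q : rule R n) :
  random_rule S l k q -> normalized_rule q.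
Proof. by case=> [[a [b [ba [bb [_ _ _ []]]]]]|[]]. Qed.

Lemma integral_is_marginal l k :
  integral_is mu [set` box S l k] (marginal S k)
    (\int[mu]_(x in [set` box S l k]) marginal S k x).
Proof.
split=> //; apply: (@integrableS _ _ _ _ setT) => //.
apply/integrableP; split.
  by apply/measurable_EFinP; exact: marginal_measurable.
rewrite (_ : (\int[mu]_x _ = \int[mu]_x (marginal S k x)%:E)%E).
  by rewrite marginal_int1 ltry.
by apply: eq_integral => x _ /=; rewrite ger0_norm// marginal_ge0.
Qed.

(** Conditioning an independent vector on a box keeps its components
    independent: the mass of the box factorizes like the joint density. *)
Lemma cell_densityE l xi :
  cell_density S l xi = \prod_k cell_marginal S l k (tnth xi k).
Proof.
rewrite /cell_density /joint_density.
have := integral_is_tuple (fun k => measurable_itv (box S l k))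
  (integral_is_marginal l).
by move=> [_ boxE]; rewrite boxE -prodf_div.
Qed.

Lemma measurable_cell_marginal l k : measurable_fun setT (cell_marginal S l k).
Proof. by apply: measurable_funM => //; exact: marginal_measurable. Qed.

Let integral_is_itv_restrict (i : interval R) (f : mR -> R) v :
  integral_is mu [set` i] f v <-> integral_is mu setT (f \_ [set` i]) v.
Proof. by apply: integral_is_restrict; exact: measurable_itv. Qed.

(** With n = ceil((KG + 1) / 2), both degrees of exactness, 2n - 1 for
    Gauss-Lobatto and 2n + 1 for Gauss, are at least [KG]. In the Gauss-Lobatto
    case the rule integrates over the closed interval against the uniform
    density, which changes the integrand only on a null set: the endpoints and
    the exceptional set of the marginal. *)
Lemma random_rule_exact KG l k (q : rule R (uphalf KG.+1)) (p : {poly R}) :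
  random_rule S l k q -> (size p <= KG.+1)%N ->
  integral_is mu [set` box S l k] (fun x => p.[x] * cell_marginal S l k x)
    (\sum_i weight q i * p.[node q i]).
Proof.
move=> [[a [b [ba [bb [ab boxE marginalE]]]]] [_ _ _ exactq]|[_ _ exactq]] sp;
  last first.
  apply: exactq; apply: leq_trans sp _.
  by lia.
have sq : (size p <= (uphalf KG.+1).*2.-1.+1)%N by lia.
have /integral_is_itv_restrict pv := exactq _ sq.
apply/integral_is_itv_restrict.
apply: ae_integral_is pv.
  apply/(measurable_restrictT _ _).1 => //.
  apply: measurable_funTS; apply: measurable_funM; first exact: measurable_poly.
  exact: measurable_cell_marginal.
have neq (c : R) : {ae mu, forall x, x != c}.
  exists [set c]; split => //; first exact: lebesgue_measure_set1.
  by move=> x /= /negP; rewrite negbK => /eqP.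
near=> x.
have xa : x != a by near: x; exact: neq.
have xb : x != b by near: x; exact: neq.
have mx : x \in box S l k -> cell_marginal S l k x = uniform_pdf a b x.
  by near: x; exact: marginalE.
rewrite !patchE !mem_setE.
have -> : (x \in `[a, b]) = (x \in box S l k).
  rewrite boxE; have [xa' xb'] := (negbTE xa, negbTE xb).
  by case: (ba); case: (bb); rewrite !in_itv/= ?le_eqVlt ?(eq_sym a) xa' xb'.
by case: ifPn => // xbox; rewrite mx.
Unshelve. all: by end_near.
Qed.

(** Both the integral of a monomial and the tensor-product rule factorize over
    the coordinates, so the one-dimensional exactness suffices. *)
Lemma tensor_rule_exact KG (rq : 'I_L -> 'I_N -> rule R (uphalf KG.+1)) l
    (m : {ffun 'I_N -> 'I_KG.+1}) : (forall k, random_rule S l k (rq l k)) ->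
  integral_is (lebesgue_tuple N) (box_set (box S l))
    (fun xi => (\prod_k tnth xi k ^+ m k) * cell_density S l xi)
    (\sum_rho rweight rq l rho * \prod_k tnth (rnode rq l rho) k ^+ m k).
Proof.
move=> rqS.
have mB k : @measurable _ mR [set` box S l k] by exact: measurable_itv.
have rule_k k : integral_is mu [set` box S l k]
    (fun x => x ^+ m k * cell_marginal S l k x)
    (\sum_i weight (rq l k) i * node (rq l k) i ^+ m k).
  have szm : (size ('X^(m k) : {poly R}) <= KG.+1)%N by rewrite size_polyXn.
  have := random_rule_exact (rqS k) szm.
  under eq_bigr do rewrite hornerXn.
  by apply: eq_integral_is => // x _; rewrite hornerXn.
have := integral_is_tuple mB rule_k.
rewrite bigA_distr_bigA/= => H.
rewrite (eq_bigr (fun rho : {ffun 'I_N -> 'I_(uphalf KG.+1).+1} =>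
    \prod_k (weight (rq l k) (rho k) *
              node (rq l k) (rho k) ^+ m k))); last first.
  move=> rho _; rewrite big_split/=; congr (_ * _).
  by apply: eq_bigr => k _; rewrite tnth_mktuple.
apply: eq_integral_is H; first exact: measurable_box_of.
by move=> xi _; rewrite big_split/= cell_densityE.
Qed.

Lemma tensor_weight_gt0 KG (rq : 'I_L -> 'I_N -> rule R (uphalf KG.+1)) l rho :
  (forall k, random_rule S l k (rq l k)) -> 0 < rweight rq l rho.
Proof.
move=> rqS; apply: prodr_gt0 => k _.
by have [_ + _] := random_rule_normalized (rqS k); exact.
Qed.

Lemma tensor_weight_sum1 KG (rq : 'I_L -> 'I_N -> rule R (uphalf KG.+1)) l :
  (forall k, random_rule S l k (rq l k)) -> \sum_rho rweight rq l rho = 1.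
Proof.
move=> rqS; rewrite /rweight -(bigA_distr_bigA (fun k i => weight (rq l k) i)).
by apply: big1 => k _; have [] := random_rule_normalized (rqS k).
Qed.

End RandomRule.

(** * Exactness under affine maps *)

Section PolyIntegral.
Context {R : realType}.
Local Notation mu := (@lebesgue_measure R).

Lemma poly_primitive (p : {poly R}) : exists P : {poly R}, P^`() = p.
Proof.
exists (\poly_(i < (size p).+1) (p`_i.-1 / i%:R)); apply/polyP => i.
rewrite coef_deriv coef_poly ltnS; case: ltnP => /= ip.
  by rewrite -(mulr_natr (_ / _)) divfK// pnatr_eq0.
by rewrite mul0rn nth_default.
Qed.

Lemma integral_is_poly (P : {poly R}) (a b : R) : a < b ->
  integral_is mu `[a, b] (fun x => P^`().[x]) (P.[b] - P.[a]).
Proof.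
move=> ab; have cP (p : {poly R}) : continuous (horner p).
  exact: continuous_horner.
apply: integral_is_fine.
  apply: continuous_compact_integrable; first exact: segment_compact.
  exact/continuous_subspaceT/cP.
rewrite (@continuous_FTC2 _ _ (horner P)) ?EFinB//.
- exact/continuous_subspaceT/cP.
- split=> [x _||]; first exact: derivable_horner.
  + exact/cvg_at_right_filter/cP.
  + exact/cvg_at_left_filter/cP.
- by move=> x _; rewrite derivE.
Qed.

Section ReferenceRule.
Variables (m n : nat) (q : rule R n).
Hypothesis exactq : exact_rule `[-1, 1] (uniform_pdf (-1) 1) m q.

Lemma rule_primitive (P : {poly R}) : (size P^`() <= m.+1)%N ->
  (\sum_i weight q i * P^`().[node q i]) *+ 2 = P.[1] - P.[-1].
Proof.
move=> /exactq[_ <-]; have ltN11 : (-1 : R) < 1 by lra.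
have mI : @measurable _ (measurableTypeR R) `[-1, 1] by exact: measurable_itv.
have [_] := integral_isZ 2^-1 mI (integral_is_poly P ltN11).
rewrite (@eq_Rintegral _ _ _ mu _ (fun x => P^`().[x] * uniform_pdf (-1) 1 x)).
  by move=> ->; field.
move=> x; rewrite mem_setE in_itv/= /uniform_pdf => ->.
by rewrite mulrC; congr (_ * _^-1); ring.
Qed.

(** A rule on [-1, 1] knows the integrals only through primitives, and these
    compose with affine maps. The slope [c] may be negative, which covers the
    reflection of the interval as well as its images. *)
Lemma rule_affine_primitive (P : {poly R}) (c e : R) : c != 0 ->
  (size P^`() <= m.+1)%N ->
  c * (\sum_i weight q i * P^`().[c * node q i + e]) *+ 2 =
  P.[c + e] - P.[- c + e].
Proof.
move=> c0 sP; pose f : {poly R} := c *: 'X + e%:P.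
have fE x : f.[x] = c * x + e by rewrite !hornerE.
have f' : f^`() = c%:P by rewrite derivD derivZ derivX derivC addr0 alg_polyC.
have P'E : (P \Po f)^`() = c *: (P^`() \Po f).
  by rewrite deriv_comp f' mulrC mul_polyC.
have := @rule_primitive (P \Po f).
rewrite P'E size_scale// size_comp_poly2; last first.
  by rewrite size_addl ?size_scale ?size_polyX// size_polyC; case: (e != 0).
move=> /(_ sP); rewrite !horner_comp !fE mulr1 mulrN1 => <-; congr (_ *+ 2).
rewrite mulr_sumr; apply: eq_bigr => i _.
by rewrite hornerZ horner_comp fE mulrCA.
Qed.

Lemma rule_affine (p : {poly R}) (a h : R) : 0 < h -> (size p <= m.+1)%N ->
  integral_is mu `[a, a + h] (horner p)
    (h * \sum_i weight q i * p.[a + h * ((1 + node q i) / 2)]).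
Proof.
move=> h0; have [P <-] := poly_primitive p => sP.
have h2 : h / 2 != 0 by rewrite gt_eqF// divr_gt0.
have := rule_affine_primitive (a + h / 2) h2 sP.
rewrite -mulrnAl -(mulr_natr (h / 2)) divfK ?pnatr_eq0//.
rewrite addrCA -splitr (addrC (- _)) addrK.
rewrite (eq_bigr (fun i => weight q i * P^`().[a + h * ((1 + node q i) / 2)])).
  by move=> ->; apply: integral_is_poly; rewrite ltrDl.
by move=> i _; congr (_ * _.[_]); field.
Qed.

Lemma rule_reflect (p : {poly R}) : (size p <= m.+1)%N ->
  \sum_i weight q i * p.[- node q i] = \sum_i weight q i * p.[node q i].
Proof.
have [P <-] := poly_primitive p => sP.
have N1 : (-1 : R) != 0 by rewrite oppr_eq0 oner_eq0.
have := rule_affine_primitive 0 N1 sP.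
rewrite opprK !addr0 -opprB -(rule_primitive sP) mulN1r mulNrn => /oppr_inj/eqP.
rewrite eqrMn2r => /eqP <-.
by apply: eq_bigr => i _; rewrite mulN1r addr0.
Qed.

End ReferenceRule.
End PolyIntegral.

(** * Symmetry of the Gauss-Lobatto end weights *)

Section LobattoWeights.
Context {R : realType}.

(** The weight at the endpoint s (s = 1 or -1) is a minimum: evaluating the rule
    on (1 + s x) p(x)^2 gives at least 2 w p(s)^2, with equality for the
    polynomial P that vanishes at the interior nodes. Applied to the competitor
    p(x) = P(-x), whose value is by reflection that of the other endpoint, this
    compares the two endpoint weights. *)
Lemma endpoint_weight_le n (q : rule R n.+1) (i0 i1 : 'I_n.+2) (s : R) :
  (forall i, 0 < weight q i) -> injective (node q) ->
  (forall i, `|node q i| <= 1) -> s ^+ 2 = 1 ->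
  node q i0 = s -> node q i1 = - s -> i0 != i1 ->
  (forall p : {poly R}, (size p <= n.*2.+2)%N ->
    \sum_i weight q i * p.[- node q i] = \sum_i weight q i * p.[node q i]) ->
  weight q i0 <= weight q i1.
Proof.
move=> w0 node_inj node1 s2 node0 nodeN neq01 reflect.
pose interior := [set i | i != i0 & i != i1]%SET.
pose P : {poly R} := \prod_(i in interior) ('X - (node q i)%:P).
have cardI : #|interior| = n.
  have -> : interior = (~: [set i0; i1])%SET.
    by apply/setP => i; rewrite !inE negb_or.
  by have := cardsC [set i0; i1]%SET; rewrite cards2 neq01 card_ord; lia.
have sP : size P = n.+1 by rewrite /P -big_enum size_prod_XsubC -cardE cardI.
have Pi i : i \in interior -> P.[node q i] = 0.
  move=> iI; rewrite horner_prod (bigD1 i)//= hornerXsubC subrr mul0r//.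
have Ps : P.[- s] != 0.
  rewrite horner_prod; apply/prodf_neq0 => i; rewrite inE => /andP[_ ni1].
  by rewrite hornerXsubC -nodeN subr_eq0 (inj_eq node_inj) eq_sym.
(* T(-x) is (1 + s x) p(x)^2 for the competitor p(x) = P(-x). *)
pose T : {poly R} := (1 - s *: 'X) * P ^+ 2.
have TE x : T.[x] = (1 - s * x) * P.[x] ^+ 2 by rewrite !hornerE.
have sT : (size T <= n.*2.+2)%N.
  rewrite (leq_trans (size_polyMleq _ _))//.
  have : (size (1 - s *: 'X : {poly R})%R <= 2)%N.
    rewrite (leq_trans (size_polyD _ _))// geq_max size_poly1 size_polyN /=.
    by rewrite (leq_trans (size_scale_leq _ _))// size_polyX.
  have : (size (P ^+ 2) <= n.*2.+1)%N.
    by rewrite (leq_trans (size_poly_exp_leq _ _))// sP/= muln2.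
  lia.
have := reflect T sT.
have -> : \sum_i weight q i * T.[node q i] = weight q i1 * (2 * P.[- s] ^+ 2).
  rewrite (bigD1 i1)//= nodeN TE mulrN opprK -expr2 s2 big1 ?addr0// => i ni1.
  have [->|ni0] := eqVneq i i0.
    by rewrite node0 TE -expr2 s2 subrr mul0r mulr0.
  by rewrite TE Pi ?inE ?ni0// expr0n/= !mulr0.
move=> sumE; rewrite -(ler_pM2r (_ : 0 < 2 * P.[- s] ^+ 2)); last first.
  by rewrite mulr_gt0// exprn_even_gt0.
rewrite -sumE (bigD1 i0)//= node0 TE mulrN opprK -expr2 s2 lerDl.
apply: sumr_ge0 => i _; rewrite TE mulr_ge0 ?(ltW (w0 _))// mulr_ge0 ?sqr_ge0//.
have : `|s * node q i| <= 1.
  rewrite normrM (_ : `|s| = 1) ?mul1r//.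
  by apply/eqP; rewrite -sqr_norm_eq1 s2.
by rewrite ler_norml => /andP[]; lra.
Qed.

(** The CFL condition speaks of the first weight only, but both end states of a
    line of nodes are updated by a flux. *)
Lemma lobatto_weight_sym n (q : rule R n.+1) : gauss_lobatto_rule (-1) 1 q ->
  weight q ord_max = weight q ord0.
Proof.
move=> [[node_mono w0 _] nodeN node1 exactq].
have node_inj : injective (node q).
  move=> i j ij.
  case: (ltngtP i j) => [lij|lij|/ord_inj//].
    by have := node_mono _ _ lij; rewrite ij ltxx.
  by have := node_mono _ _ lij; rewrite ij ltxx.
have node_le (i j : 'I_n.+2) : (i <= j)%N -> node q i <= node q j.
  by rewrite leq_eqVlt => /orP[/eqP/val_inj->//|/node_mono/ltW].
have norm1 i : `|node q i| <= 1.
  rewrite ler_norml -nodeN -[X in _ && (_ <= X)]node1 !node_le//.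
  by rewrite /= -ltnS.
have refl (p : {poly R}) := @rule_reflect R _ _ _ exactq p.
have le0 : weight q ord0 <= weight q ord_max.
  by apply: (@endpoint_weight_le n q ord0 ord_max (-1)) => //;
    rewrite ?sqrrN ?expr1n ?opprK.
have leN : weight q ord_max <= weight q ord0.
  by apply: (@endpoint_weight_le n q ord_max ord0 1) => //; rewrite expr1n.
by apply/eqP; rewrite eq_le leN le0.
Qed.

End LobattoWeights.

(** * Convex combinations and first-order updates *)

Section ConvexCombination.
Context {R : realType} {d : nat} (adm : set 'rV[R]_d).
Hypothesis adm_convex : convex_set adm.

Lemma convex_set_pair (t : R) (x y : 'rV[R]_d) : 0 <= t <= 1 ->
  adm x -> adm y -> adm (t *: x + (1 - t) *: y).
Proof.
move=> /andP[t0 t1] xA yA; apply: set_mem.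
by have := adm_convex (Itv01 t0 t1) (mem_set xA) (mem_set yA).
Qed.

(** Induction needs the partial sums, whose weights do not add up to 1; they are
    divided by their total weight. *)
Lemma convex_set_sum (I : finType) (P : pred I) (w : I -> R)
    (x : I -> 'rV[R]_d) : (forall i, P i -> 0 < w i) ->
  \sum_(i | P i) w i = 1 -> (forall i, P i -> adm (x i)) ->
  adm (\sum_(i | P i) w i *: x i).
Proof.
move=> w0 w1 xA.
suff sumA (s : seq I) : 0 < \sum_(i <- s | P i) w i ->
    adm ((\sum_(i <- s | P i) w i)^-1 *: \sum_(i <- s | P i) w i *: x i).
  by have := sumA (index_enum I); rewrite w1 invr1 scale1r; apply; exact: ltr01.
elim: s => [|i s IH]; first by rewrite big_nil ltxx.
rewrite !big_cons; case: ifP => // Pi.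
set W := \sum_(j <- s | P j) w j; set X := \sum_(j <- s | P j) w j *: x j.
have wi := w0 _ Pi.
have [W0|W0] := eqVneq W 0.
  rewrite W0 addr0 => _.
  have -> : X = 0.
    have /eqP := W0; rewrite /W psumr_eq0 => [/allP wj0|j Pj]; last exact/ltW/w0.
    rewrite /X big_seq_cond big1// => j /andP[js Pj].
    by have := wj0 _ js; rewrite Pj/= => /eqP ->; rewrite scale0r.
  by rewrite addr0 scalerA mulVf ?gt_eqF// scale1r; exact: xA.
have Wgt : 0 < W by rewrite lt_neqAle eq_sym W0 sumr_ge0// => j /w0/ltW.
move=> wW; have -> : (w i + W)^-1 *: (w i *: x i + X) =
    (w i / (w i + W)) *: x i + (1 - w i / (w i + W)) *: (W^-1 *: X).
  rewrite scalerDr !scalerA mulrC; congr (_ + _ *: _).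
  by field; rewrite W0 gt_eqF.
apply: convex_set_pair; [|exact: xA|exact: IH].
by rewrite divr_ge0 ?(ltW wi) ?(ltW wW)//= ler_pdivrMr// mul1r lerDl ltW.
Qed.

Lemma convex_set_sum2 (I J : finType) (v : I -> R) (w : J -> R)
    (x : I -> J -> 'rV[R]_d) : (forall i, 0 < v i) -> (forall j, 0 < w j) ->
  \sum_i v i = 1 -> \sum_j w j = 1 -> (forall i j, adm (x i j)) ->
  adm (\sum_i \sum_j (v i * w j) *: x i j).
Proof.
move=> v0 w0 v1 w1 xA; rewrite pair_bigA/=.
apply: (convex_set_sum (w := fun k => v k.1 * w k.2)
  (x := fun k => x k.1 k.2)) => [k _||k _]; [exact: mulr_gt0| |exact: xA].
rewrite -(pair_bigA _ (fun i j => v i * w j))/=.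
by under eq_bigr do rewrite -mulr_sumr w1 mulr1.
Qed.

Variables (f : 'rV[R]_d -> 'rV[R]_d) (lam C : R)
  (fhat : 'rV[R]_d -> 'rV[R]_d -> 'rV[R]_d).
Hypothesis fhat_pp : positivity_preserving adm f lam C fhat.

(** Adding and subtracting the flux between the two end states of the line turns
    the update of the average into an average of first-order updates: w_0 times
    one at each end node, with step [r / w ord0], and the unchanged states at
    the interior nodes. This is where the factor [w ord0] in the CFL condition
    comes from. *)
Lemma line_update_admissible n (w : 'I_n.+2 -> R) (x : 'I_n.+2 -> 'rV[R]_d)
    (a c : 'rV[R]_d) (r : R) :
  (forall i, 0 < w i) -> \sum_i w i = 1 -> w ord_max = w ord0 ->
  (forall v, ([set a; c] `|` range x) v ->
    adm v /\ eigenvalues_bounded f lam v) ->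
  0 < r -> lam * r <= C * w ord0 ->
  adm (\sum_i w i *: x i - r *: (fhat (x ord_max) c - fhat a (x ord0))).
Proof.
move=> w0 w1 wsym pts r0 cfl.
have [aA aE] : adm a /\ eigenvalues_bounded f lam a.
  by apply: pts; left; left.
have [cA cE] : adm c /\ eigenvalues_bounded f lam c.
  by apply: pts; left; right.
have xAE i : adm (x i) /\ eigenvalues_bounded f lam (x i).
  by apply: pts; right; exists i.
have xA i := (xAE i).1; have xE i := (xAE i).2.
have n0 : ord_max != ord0 :> 'I_n.+2 by [].
pose rho := r / w ord0.
have rho0 : 0 < rho by rewrite divr_gt0.
have lam_rho : lam * rho <= C by rewrite mulrA ler_pdivrMr.
pose y i := if i == ord0 then
    x i - rho *: (fhat (x ord0) (x ord_max) - fhat a (x ord0))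
  else if i == ord_max then
    x i - rho *: (fhat (x ord_max) c - fhat (x ord0) (x ord_max))
  else x i.
have -> : \sum_i w i *: x i - r *: (fhat (x ord_max) c - fhat a (x ord0)) =
    \sum_i w i *: y i.
  have wrho : w ord0 * rho = r by rewrite mulrC divfK// gt_eqF.
  rewrite (bigD1 ord0)//= (bigD1 ord_max)//= [RHS](bigD1 ord0)//=.
  rewrite [in RHS](bigD1 ord_max)//=.
  rewrite /y !eqxx (negbTE n0) wsym !scalerBr !scalerA wrho.
  rewrite [in RHS](eq_bigr (fun i => w i *: x i)); last first.
    by move=> i /andP[/negbTE -> /negbTE ->].
  by set Z := \sum_(i < _ | _) _; apply/rowP => k; rewrite !mxE; ring.
have step b1 b2 b3 : adm b1 /\ eigenvalues_bounded f lam b1 ->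
    adm b2 /\ eigenvalues_bounded f lam b2 ->
    adm b3 /\ eigenvalues_bounded f lam b3 ->
    adm (b2 - rho *: (fhat b2 b3 - fhat b1 b2)).
  by move=> [A1 E1] [A2 E2] [A3 E3]; exact: fhat_pp.
apply: convex_set_sum => [i _|//|i _]; first exact: w0.
rewrite /y; case: ifP => [/eqP ->|_]; first exact: step.
case: ifP => [/eqP ->|_]; first exact: step.
exact: xA.
Qed.

End ConvexCombination.

Section DoubleSum.
Context {R : realType} {d : nat}.

Lemma sum2_scaleB (I J : finType) (c : I -> J -> R)
    (x y : I -> J -> 'rV[R]_d) (r : R) :
  \sum_i \sum_j c i j *: (x i j - r *: y i j) =
  \sum_i \sum_j c i j *: x i j - r *: \sum_i \sum_j c i j *: y i j.
Proof.
rewrite scaler_sumr -sumrB; apply: eq_bigr => i _.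
rewrite scaler_sumr -sumrB; apply: eq_bigr => j _.
by rewrite scalerBr !scalerA mulrC.
Qed.

End DoubleSum.

(** * Cell integrals of piecewise polynomials *)

Section Cell.
Context {R : realType} {N L : nat} (M : mesh R) (S : random_space R N L).
Local Notation mR := (measurableTypeR R).
Local Notation mu := (@lebesgue_measure R).

Lemma exact_rule_leq (D : set R) f m m' n (q : rule R n) : (m <= m')%N ->
  exact_rule D f m' q -> exact_rule D f m q.
Proof. by move=> mm' qE p sp; apply: qE; exact: leq_trans sp _. Qed.

Lemma xfaceS i : xface M (i + 1) = xface M i + dx M.
Proof. by rewrite /xface intrD mulrDl mul1r addrA. Qed.

Lemma yfaceS j : yface M (j + 1) = yface M j + dy M.
Proof. by rewrite /yface intrD mulrDl mul1r addrA. Qed.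

Let measurable_face (a b : R) : @measurable _ mR `[a, b].
Proof. exact: measurable_itv. Qed.

(** The rule in one direction need not be the one of the other: the cell mean is
    computed with Gauss-Lobatto nodes in x and Gauss-Legendre nodes in y, and
    conversely. *)
Lemma cell_rule_exact KX n1 n2 (qx : rule R n1) (qy : rule R n2)
    (C : 'I_KX.+1 -> 'I_KX.+1 -> R) i j :
  exact_rule `[-1, 1] (uniform_pdf (-1) 1) KX qx ->
  exact_rule `[-1, 1] (uniform_pdf (-1) 1) KX qy ->
  let g x y := \sum_m1 \sum_m2 C m1 m2 * x ^+ m1 * y ^+ m2 in
  integral_is (mu \x mu)%E (cell M i j) (fun z => g z.1 z.2)
    (dx M * dy M * \sum_a \sum_b weight qx a * weight qy b *
       g (xnode M i (node qx a)) (ynode M j (node qy b))).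
Proof.
move=> qxE qyE g.
have mC : measurable (cell M i j : set (mR * mR)).
  by apply: measurableX; exact: measurable_face.
have X (m : 'I_KX.+1) : integral_is mu `[xface M i, xface M (i + 1)]
    (fun x => x ^+ m) (dx M * \sum_a weight qx a * xnode M i (node qx a) ^+ m).
  have sz : (size ('X^m : {poly R}) <= KX.+1)%N by rewrite size_polyXn.
  have := rule_affine qxE (xface M i) (dx_gt0 M) sz.
  under eq_bigr do rewrite hornerXn.
  by rewrite xfaceS; apply: eq_integral_is => // x _; rewrite hornerXn.
have Y (m : 'I_KX.+1) : integral_is mu `[yface M j, yface M (j + 1)]
    (fun x => x ^+ m) (dy M * \sum_a weight qy a * ynode M j (node qy a) ^+ m).
  have sz : (size ('X^m : {poly R}) <= KX.+1)%N by rewrite size_polyXn.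
  have := rule_affine qyE (yface M j) (dy_gt0 M) sz.
  under eq_bigr do rewrite hornerXn.
  by rewrite yfaceS; apply: eq_integral_is => // x _; rewrite hornerXn.
have XY m1 m2 := integral_isZ (C m1 m2) mC
  (integral_is_prod (measurable_face _ _) (measurable_face _ _) (X m1) (Y m2)).
have := integral_is_sum (index_enum _) mC (fun m1 (_ : xpredT m1) =>
  integral_is_sum (index_enum _) mC (fun m2 (_ : xpredT m2) => XY m1 m2)).
set v1 := (X in integral_is _ _ _ X -> _).
set v2 := (X in _ -> integral_is _ _ _ X).
have -> : v1 = v2.
  rewrite /v1 /v2 /g.
  under [in RHS]eq_bigr => a _ do under eq_bigr => b _ do
    (rewrite mulr_sumr; under eq_bigr => m1 _ do rewrite mulr_sumr).
  under [in RHS]eq_bigr => a _ do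
    (rewrite exchange_big/=; under eq_bigr => m1 _ do rewrite exchange_big/=).
  rewrite [in RHS]exchange_big/= [in RHS]mulr_sumr; apply: eq_bigr => m1 _.
  rewrite [in RHS]exchange_big/= [in RHS]mulr_sumr; apply: eq_bigr => m2 _.
  rewrite [in LHS]mulrACA [LHS]mulrCA big_distrlr/=; congr (_ * _).
  rewrite mulr_sumr; apply: eq_bigr => a _.
  by rewrite mulr_sumr; apply: eq_bigr => b _; ring.
apply: eq_integral_is => // z _.
by apply: eq_bigr => m1 _; apply: eq_bigr => m2 _; rewrite mulrA.
Qed.

Section Exact.
Variables (KX KG : nat) (rq : 'I_L -> 'I_N -> rule R (uphalf KG.+1)) (l : 'I_L).
Hypothesis rqS : forall k, random_rule S l k (rq l k).

Lemma random_integral_exact (g : R -> R -> rvec R N -> R) x y :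
  dsg_space KX KG g ->
  \int[lebesgue_tuple N]_(xi in box_set (box S l))
    (g x y xi * cell_density S l xi) =
  \sum_rho rweight rq l rho * g x y (rnode rq l rho).
Proof.
move=> [c gE].
have mB : measurable (box_set (box S l)).
  exact: (measurable_box_of (fun k => measurable_itv (box S l k))).
have mono m1 m2 m := integral_isZ (c m1 m2 m * x ^+ m1 * y ^+ m2) mB
  (tensor_rule_exact m rqS).
have := integral_is_sum (index_enum _) mB (fun m1 (_ : xpredT m1) =>
  integral_is_sum (index_enum _) mB (fun m2 (_ : xpredT m2) =>
  integral_is_sum (index_enum _) mB
    (fun m (_ : (\sum_k (m : {ffun 'I_N -> 'I_KG.+1}) k <= KG)%N) =>
       mono m1 m2 m))).
move=> [_]; rewrite (@eq_Rintegral _ _ _ _ _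
  (fun xi => g x y xi * cell_density S l xi)).
  move=> ->; symmetry.
  under eq_bigr => rho _ do rewrite gE mulr_sumr.
  rewrite exchange_big/=; apply: eq_bigr => m1 _.
  under eq_bigr => rho _ do rewrite mulr_sumr.
  rewrite exchange_big/=; apply: eq_bigr => m2 _.
  under eq_bigr => rho _ do rewrite mulr_sumr.
  rewrite exchange_big/=; apply: eq_bigr => m _.
  by rewrite mulr_sumr; apply: eq_bigr => rho _; rewrite mulrCA.
move=> xi _; rewrite gE mulr_suml; apply: eq_bigr => m1 _.
rewrite mulr_suml; apply: eq_bigr => m2 _.
by rewrite mulr_suml; apply: eq_bigr => m _; rewrite mulrA.
Qed.

Lemma cell_integral_exact n1 n2 (qx : rule R n1) (qy : rule R n2) i j
    (g : R -> R -> rvec R N -> R) : dsg_space KX KG g ->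
  exact_rule `[-1, 1] (uniform_pdf (-1) 1) KX qx ->
  exact_rule `[-1, 1] (uniform_pdf (-1) 1) KX qy ->
  cell_integral M S i j l g = dx M * dy M *
    \sum_rho \sum_a \sum_b rweight rq l rho * (weight qx a * weight qy b) *
      g (xnode M i (node qx a)) (ynode M j (node qy b)) (rnode rq l rho).
Proof.
move=> gV qxE qyE; rewrite /cell_integral.
transitivity (\int[(mu \x mu)%E]_(z in cell M i j)
    (\sum_rho rweight rq l rho * g z.1 z.2 (rnode rq l rho))).
  by apply: eq_Rintegral => z _; exact: random_integral_exact.
have mC : measurable (cell M i j : set (mR * mR)).
  by apply: measurableX; exact: measurable_face.
have [c gE] := gV.
have slice rho : integral_is (mu \x mu)%E (cell M i j)
    (fun z => rweight rq l rho * g z.1 z.2 (rnode rq l rho))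
    (rweight rq l rho * (dx M * dy M * \sum_a \sum_b weight qx a * weight qy b *
      g (xnode M i (node qx a)) (ynode M j (node qy b)) (rnode rq l rho))).
  apply: integral_isZ => //.
  pose C (m1 m2 : 'I_KX.+1) := \sum_(m : {ffun 'I_N -> 'I_KG.+1} |
    (\sum_k m k <= KG)%N) c m1 m2 m * \prod_k tnth (rnode rq l rho) k ^+ m k.
  have gC x y : g x y (rnode rq l rho) =
      \sum_m1 \sum_m2 C m1 m2 * x ^+ m1 * y ^+ m2.
    rewrite gE; apply: eq_bigr => m1 _; apply: eq_bigr => m2 _.
    by rewrite !mulr_suml; apply: eq_bigr => m _; ring.
  have /= := cell_rule_exact C i j qxE qyE.
  under eq_bigr => a _ do under eq_bigr => b _ do rewrite -gC.
  by apply: eq_integral_is => // z _; rewrite gC.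
have [_ sumE] := integral_is_sum (index_enum _) mC
  (fun rho (_ : xpredT rho) => slice rho).
rewrite [LHS]sumE [RHS]mulr_sumr; apply: eq_bigr => rho _.
rewrite [LHS]mulrCA; congr (_ * _).
rewrite mulr_sumr; apply: eq_bigr => a _.
by rewrite mulr_sumr; apply: eq_bigr => b _; exact: mulrA.
Qed.

End Exact.
End Cell.

Section CellMean.
Context {R : realType} {d N L : nat} (KX KG : nat).
Variables (M : mesh R) (S : random_space R N L).
Variables (rq : 'I_L -> 'I_N -> rule R (uphalf KG.+1)) (l : 'I_L).
Hypothesis rqS : forall k, random_rule S l k (rq l k).

Lemma dsg_space1 : @dsg_space R N KX KG (fun _ _ _ => 1).
Proof.
exists (fun m1 m2 m =>
  ((m1 == ord0) && (m2 == ord0) && (m == [ffun=> ord0]))%:R).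
move=> x y xi; rewrite (bigD1 ord0)//= (bigD1 ord0)//= (bigD1 [ffun=> ord0])/=.
  rewrite !eqxx !mul1r [\prod_k _]big1 => [|k _]; last by rewrite ffunE.
  rewrite !big1 ?addr0// => [m1 /negbTE m10|m2 /negbTE m20|m /andP[_ /negbTE mn]].
  - by rewrite big1// => m2 _; rewrite big1// => m _; rewrite m10 !mul0r.
  - by rewrite big1// => m _; rewrite m20 !mul0r.
  - by rewrite mn !mul0r.
by rewrite big1// => k _; rewrite ffunE.
Qed.

Lemma cell_integral1 n (q : rule R n) i j : normalized_rule q ->
  exact_rule `[-1, 1] (uniform_pdf (-1) 1) KX q ->
  cell_integral M S i j l (fun _ _ _ => 1) = dx M * dy M.
Proof.
move=> [_ _ q1] qE; rewrite (cell_integral_exact M rqS i j dsg_space1 qE qE).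
rewrite -[RHS]mulr1 -[X in _ = _ * X](tensor_weight_sum1 rqS); congr (_ * _).
apply: eq_bigr => rho _.
under eq_bigr => a _ do under eq_bigr => b _ do rewrite mulr1.
under eq_bigr => a _ do rewrite -mulr_sumr -mulr_sumr q1 mulr1.
by rewrite -mulr_sumr q1 mulr1.
Qed.

Lemma cell_mean_exact n1 n2 (qx : rule R n1) (qy : rule R n2)
    (u : int -> int -> 'I_L -> R -> R -> rvec R N -> 'rV[R]_d) i j :
  (forall c, dsg_space KX KG (fun x y xi => u i j l x y xi 0 c)) ->
  normalized_rule qx -> normalized_rule qy ->
  exact_rule `[-1, 1] (uniform_pdf (-1) 1) KX qx ->
  exact_rule `[-1, 1] (uniform_pdf (-1) 1) KX qy ->
  cell_mean M S u i j l = \sum_rho \sum_a \sum_b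
    (rweight rq l rho * (weight qx a * weight qy b)) *:
    u i j l (xnode M i (node qx a)) (ynode M j (node qy b)) (rnode rq l rho).
Proof.
move=> uV qxN qyN qxE qyE; rewrite /cell_mean (cell_integral1 i j qxN qxE).
have dxy0 : dx M * dy M != 0 by rewrite gt_eqF// mulr_gt0// ?dx_gt0 ?dy_gt0.
apply/rowP => c; rewrite !mxE (cell_integral_exact M rqS i j (uV c) qxE qyE).
rewrite mulKf// summxE; apply: eq_bigr => rho _.
rewrite summxE; apply: eq_bigr => a _.
by rewrite summxE; apply: eq_bigr => b _; rewrite mxE.
Qed.

End CellMean.

(** * Evolution of the cell mean *)

Section EulerMean.
Context {R : realType} {d N L KX KG QL : nat}.
Variables (M : mesh R) (S : random_space R N L) (lg : rule R QL).
Variables (rq : 'I_L -> 'I_N -> rule R (uphalf KG.+1)).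
Variables (f1 f2 : 'rV[R]_d -> 'rV[R]_d).
Variables (fhat1 fhat2 : 'rV[R]_d -> 'rV[R]_d -> 'rV[R]_d).
Variables (Q : int -> int -> 'I_L -> (R -> R -> rvec R N -> 'rV[R]_d) ->
  'rV[R]_d).
Hypothesis Q_linear : linear_quadrature Q.

Lemma linear_quadrature0 i j l : Q i j l (fun _ _ _ => 0) = 0.
Proof.
have := Q_linear i j l 1 (fun _ _ _ => 0) (fun _ _ _ => 0).
under eq_fun do under eq_fun do under eq_fun do rewrite scaler0 addr0.
rewrite scale1r => /eqP.
by rewrite -subr_eq0 opprD addrA subrr sub0r oppr_eq0 => /eqP.
Qed.

(** The scheme tested with v = 1: the volume term disappears because v has no
    gradient and [Q] is linear. *)
Lemma euler_cell_mean dt u unew i j l :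
  (forall k, random_rule S l k (rq l k)) ->
  normalized_rule lg ->
  exact_rule `[-1, 1] (uniform_pdf (-1) 1) KX lg ->
  dt != 0 -> cells M (i, j) ->
  euler_step KX M S lg rq f1 f2 fhat1 fhat2 Q dt u unew ->
  cell_mean M S unew i j l = cell_mean M S u i j l
    - (dt / dx M) *: (\sum_rho \sum_q (rweight rq l rho * weight lg q) *:
        (xflux M lg rq fhat1 u (i + 1) j l q rho
         - xflux M lg rq fhat1 u i j l q rho))
    - (dt / dy M) *: (\sum_rho \sum_p (rweight rq l rho * weight lg p) *:
        (yflux M lg rq fhat2 u i (j + 1) l p rho
         - yflux M lg rq fhat2 u i j l p rho)).
Proof.
move=> rqS lgN lgE dt0 ij /(_ i j l _ ij (dsg_space1 KX KG)).
have scale1 (w : R -> R -> rvec R N -> 'rV[R]_d) :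
    (fun x y xi => 1 *: w x y xi) = w.
  by apply/funext => x; apply/funext => y; apply/funext => xi; rewrite scale1r.
have volume0 : (fun x y (xi : rvec R N) =>
    derive1 (fun=> 1 : R) x *: f1 (u i j l x y xi) +
    derive1 (fun=> 1 : R) y *: f2 (u i j l x y xi)) = (fun _ _ _ => 0).
  apply/funext => x; apply/funext => y; apply/funext => xi.
  by rewrite !derive1_cst !scale0r addr0.
rewrite /dsg_rhs !scale1 volume0 linear_quadrature0 sub0r.
rewrite /cell_mean (cell_integral1 M rqS i j lgN lgE).
under eq_bigr => q _ do under eq_bigr => rho _ do rewrite !scale1r mulrC.
under [X in _ = _ - _ *: X]eq_bigr => q _ do
  under eq_bigr => rho _ do rewrite !scale1r mulrC.
rewrite exchange_big/= [X in _ = _ - _ *: X]exchange_big/=.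
set A := \sum_rho _; set B := \sum_rho _.
set v := cell_integralv _ _ _ _ _ _; set w := cell_integralv _ _ _ _ _ _.
move=> /(congr1 (fun z => dt *: z)); rewrite scalerA mulfV// scale1r => /eqP.
rewrite subr_eq => /eqP ->.
have [dx0 dy0] : dx M != 0 /\ dy M != 0 by rewrite !gt_eqF ?dx_gt0 ?dy_gt0.
apply/rowP => c; rewrite !mxE; field.
by rewrite dx0 dy0.
Qed.

End EulerMean.

(** * Admissibility of the cell mean *)

Section Lines.
Context {R : realType} {d N L KX KG QL : nat}.
Variables (f1 f2 : 'rV[R]_d -> 'rV[R]_d).
Let adm := hyperbolicity_set f1 f2.
Hypothesis adm_convex : convex_set adm.
Variables (M : mesh R) (gl : rule R (uphalf KX.+1)) (lg : rule R QL).
Variables (rq : 'I_L -> 'I_N -> rule R (uphalf KG.+1)).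
Variables (u : int -> int -> 'I_L -> R -> R -> rvec R N -> 'rV[R]_d).
Hypothesis gl_lobatto : gauss_lobatto_rule (-1) 1 gl.
Hypothesis u_adm : forall i j l v, extended_cells M (i, j) ->
  point_values M gl lg rq u i j l v -> adm v.

Let xnode_left i : xnode M i (node gl ord0) = xface M i.
Proof.
by case: gl_lobatto => _ -> _ _; rewrite /xnode subrr mul0r mulr0 addr0.
Qed.

Let xnode_right i : xnode M i (node gl ord_max) = xface M (i + 1).
Proof.
by case: gl_lobatto => _ _ -> _; rewrite /xnode xfaceS divff ?mulr1// pnatr_eq0.
Qed.

Let ynode_left j : ynode M j (node gl ord0) = yface M j.
Proof.
by case: gl_lobatto => _ -> _ _; rewrite /ynode subrr mul0r mulr0 addr0.
Qed.

Let ynode_right j : ynode M j (node gl ord_max) = yface M (j + 1).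
Proof.
by case: gl_lobatto => _ _ -> _; rewrite /ynode yfaceS divff ?mulr1// pnatr_eq0.
Qed.

(** The Gauss-Lobatto nodes contain the endpoints, so the four traces entering
    the two fluxes are states at nodes of the three cells around. *)
Lemma xline_admissible fhat lam C r i j l q rho :
  positivity_preserving adm f1 lam C fhat ->
  (forall i j l v, extended_cells M (i, j) ->
    point_values M gl lg rq u i j l v -> eigenvalues_bounded f1 lam v) ->
  cells M (i, j) -> 0 < r -> lam * r <= C * weight gl ord0 ->
  adm (\sum_a weight gl a *:
      u i j l (xnode M i (node gl a)) (ynode M j (node lg q)) (rnode rq l rho)
    - r *: (xflux M lg rq fhat u (i + 1) j l q rho
            - xflux M lg rq fhat u i j l q rho)).
Proof.
move=> fhat_pp bounded ij r0 cfl; have [[_ w0 w1] _ _ _] := gl_lobatto.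
pose U i' a := u i' j l (xnode M i' (node gl a)) (ynode M j (node lg q))
  (rnode rq l rho).
have UP i' a : extended_cells M (i', j) ->
    adm (U i' a) /\ eigenvalues_bounded f1 lam (U i' a).
  by move=> ij'; split; [apply: u_adm ij' _|apply: bounded ij' _];
    left; exists a, q, rho.
have -> : xflux M lg rq fhat u (i + 1) j l q rho =
    fhat (U i ord_max) (U (i + 1) ord0).
  by rewrite /xflux /U addrK xnode_left xnode_right.
have -> : xflux M lg rq fhat u i j l q rho =
    fhat (U (i - 1) ord_max) (U i ord0).
  by rewrite /xflux /U xnode_left xnode_right subrK.
apply: (line_update_admissible adm_convex fhat_pp w0 w1
  (lobatto_weight_sym gl_lobatto) _ r0 cfl) => v [[->|->]|[a _ <-]]; apply: UP.
- by right; left; rewrite /= subrK.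
- by right; right; left; rewrite /= addrK.
- by left.
Qed.

Lemma yline_admissible fhat lam C r i j l p rho :
  positivity_preserving adm f2 lam C fhat ->
  (forall i j l v, extended_cells M (i, j) ->
    point_values M gl lg rq u i j l v -> eigenvalues_bounded f2 lam v) ->
  cells M (i, j) -> 0 < r -> lam * r <= C * weight gl ord0 ->
  adm (\sum_b weight gl b *:
      u i j l (xnode M i (node lg p)) (ynode M j (node gl b)) (rnode rq l rho)
    - r *: (yflux M lg rq fhat u i (j + 1) l p rho
            - yflux M lg rq fhat u i j l p rho)).
Proof.
move=> fhat_pp bounded ij r0 cfl; have [[_ w0 w1] _ _ _] := gl_lobatto.
pose U j' b := u i j' l (xnode M i (node lg p)) (ynode M j' (node gl b))
  (rnode rq l rho).
have UP j' b : extended_cells M (i, j') ->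
    adm (U j' b) /\ eigenvalues_bounded f2 lam (U j' b).
  by move=> ij'; split; [apply: u_adm ij' _|apply: bounded ij' _];
    right; exists p, b, rho.
have -> : yflux M lg rq fhat u i (j + 1) l p rho =
    fhat (U j ord_max) (U (j + 1) ord0).
  by rewrite /yflux /U addrK ynode_left ynode_right.
have -> : yflux M lg rq fhat u i j l p rho =
    fhat (U (j - 1) ord_max) (U j ord0).
  by rewrite /yflux /U ynode_left ynode_right subrK.
apply: (line_update_admissible adm_convex fhat_pp w0 w1
  (lobatto_weight_sym gl_lobatto) _ r0 cfl) => v [[->|->]|[b _ <-]]; apply: UP.
- by right; right; right; left; rewrite /= subrK.
- by right; right; right; right; rewrite /= addrK.
- by left.
Qed.

End Lines.

Theorem theorem3p8 (R : realType) (d N L KX KG QL : nat)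
    (f1 f2 : 'rV[R]_d -> 'rV[R]_d)
    (adm_open : open (hyperbolicity_set f1 f2))
    (adm_convex : convex_set (hyperbolicity_set f1 f2))
    (M : mesh R) (S : random_space R N L)
    (gl : rule R (uphalf KX.+1))
    (gl_lobatto : gauss_lobatto_rule (-1) 1 gl)
    (lg : rule R QL)
    (lg_legendre : gauss_legendre_rule (-1) 1 lg)
    (lg_exact : (KX <= QL.*2.+1)%N)
    (rq : 'I_L -> 'I_N -> rule R (uphalf KG.+1))
    (rq_rule : forall l k, random_rule S l k (rq l k))
    (Q : int -> int -> 'I_L -> (R -> R -> rvec R N -> 'rV[R]_d) -> 'rV[R]_d)
    (Q_linear : linear_quadrature Q)
    (fhat1 fhat2 : 'rV[R]_d -> 'rV[R]_d -> 'rV[R]_d)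
    (lam1 lam2 C : R) (lam1_gt0 : 0 < lam1) (lam2_gt0 : 0 < lam2)
    (C_gt0 : 0 < C) (C_le1 : C <= 1)
    (fhat1_pp :
      positivity_preserving (hyperbolicity_set f1 f2) f1 lam1 C fhat1)
    (fhat2_pp :
      positivity_preserving (hyperbolicity_set f1 f2) f2 lam2 C fhat2)
    (dt : R) (dt_gt0 : 0 < dt)
    (u unew : int -> int -> 'I_L -> R -> R -> rvec R N -> 'rV[R]_d)
    (u_poly : approximation_space KX KG M u)
    (unew_poly : approximation_space KX KG M unew)
    (u_adm : forall i j l v, extended_cells M (i, j) ->
      point_values M gl lg rq u i j l v -> hyperbolicity_set f1 f2 v)
    (lam_bound : forall i j l v, extended_cells M (i, j) ->
      point_values M gl lg rq u i j l v ->
      eigenvalues_bounded f1 lam1 v /\ eigenvalues_bounded f2 lam2 v)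
    (step : euler_step KX M S lg rq f1 f2 fhat1 fhat2 Q dt u unew)
    (cfl : lam1 * (dt / dx M) + lam2 * (dt / dy M) <= C * weight gl ord0) :
  forall i j l, cells M (i, j) ->
    hyperbolicity_set f1 f2 (cell_mean M S unew i j l).
Proof.
move=> i j l ij.
have [glN _ _ glE'] := gl_lobatto.
have [lgN _ lgE'] := lg_legendre; have [_ lg0 lg1] := lgN.
have {glE'} glE : exact_rule `[-1, 1] (uniform_pdf (-1) 1) KX gl.
  by apply: exact_rule_leq glE'; lia.
have {lgE'} lgE : exact_rule `[-1, 1] (uniform_pdf (-1) 1) KX lg.
  exact: exact_rule_leq lg_exact lgE'.
have rqS := rq_rule l.
have uV c : dsg_space KX KG (fun x y xi => u i j l x y xi 0 c).
  exact: u_poly.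
rewrite (euler_cell_mean Q_linear rqS lgN lgE (lt0r_neq0 dt_gt0) ij step).
pose l1 := lam1 * (dt / dx M); pose l2 := lam2 * (dt / dy M).
have r1gt : 0 < dt / dx M by rewrite divr_gt0// dx_gt0.
have r2gt : 0 < dt / dy M by rewrite divr_gt0// dy_gt0.
have l1gt : 0 < l1 by rewrite mulr_gt0.
have l2gt : 0 < l2 by rewrite mulr_gt0.
have l12gt : 0 < l1 + l2 by rewrite addr_gt0.
(* The share of the cell mean given to direction x is proportional to its CFL
   number, so that [lam1 * r1] and [lam2 * r2] are both [l1 + l2]. *)
pose s := l1 / (l1 + l2).
have sC : 1 - s = l2 / (l1 + l2) by rewrite /s; field; rewrite gt_eqF.
have s0 : 0 < s by rewrite divr_gt0.
have sC0 : 0 < 1 - s by rewrite sC divr_gt0.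
pose r1 := dt / dx M / s; pose r2 := dt / dy M / (1 - s).
have lam_r1 : lam1 * r1 <= C * weight gl ord0.
  by rewrite mulrA -/l1 /s invf_div mulrCA divff ?mulr1// gt_eqF.
have lam_r2 : lam2 * r2 <= C * weight gl ord0.
  by rewrite mulrA -/l2 sC invf_div mulrCA divff ?mulr1// gt_eqF.
pose X rho q := \sum_a weight gl a *:
  u i j l (xnode M i (node gl a)) (ynode M j (node lg q)) (rnode rq l rho).
pose Y rho p := \sum_b weight gl b *:
  u i j l (xnode M i (node lg p)) (ynode M j (node gl b)) (rnode rq l rho).
pose W rho q := rweight rq l rho * weight lg q.
(* One and the same mean by two rules: Gauss-Lobatto nodes along x in the
   first, along y in the second. *)
have meanX : cell_mean M S u i j l = \sum_rho \sum_q W rho q *: X rho q.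
  rewrite (cell_mean_exact M rqS uV glN lgN glE lgE).
  apply: eq_bigr => rho _; rewrite exchange_big; apply: eq_bigr => q _.
  rewrite scaler_sumr; apply: eq_bigr => a _.
  by rewrite scalerA /W -mulrA (mulrC (weight lg q)).
have meanY : cell_mean M S u i j l = \sum_rho \sum_p W rho p *: Y rho p.
  rewrite (cell_mean_exact M rqS uV lgN glN lgE glE).
  apply: eq_bigr => rho _; apply: eq_bigr => p _.
  by rewrite scaler_sumr; apply: eq_bigr => b _; rewrite scalerA /W mulrA.
set DF := fun rho q => xflux M lg rq fhat1 u (i + 1) j l q rho
                       - xflux M lg rq fhat1 u i j l q rho.
set DG := fun rho p => yflux M lg rq fhat2 u i (j + 1) l p rho
                       - yflux M lg rq fhat2 u i j l p rho.
have split_mean : cell_mean M S u i j l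
      - (dt / dx M) *: (\sum_rho \sum_q W rho q *: DF rho q)
      - (dt / dy M) *: (\sum_rho \sum_p W rho p *: DG rho p) =
    s *: (\sum_rho \sum_q W rho q *: (X rho q - r1 *: DF rho q)) +
    (1 - s) *: (\sum_rho \sum_p W rho p *: (Y rho p - r2 *: DG rho p)).
  rewrite !sum2_scaleB -meanX -meanY.
  move: (cell_mean M S u i j l) => m; rewrite !scalerBr !scalerA.
  rewrite [s * r1]mulrC [(1 - s) * r2]mulrC !divfK ?gt_eqF//.
  by rewrite addrACA -scalerDl [s + _]addrC subrK scale1r addrA.
rewrite split_mean; apply: convex_set_pair => //.
- by rewrite (ltW s0) -subr_ge0 (ltW sC0).
- apply: convex_set_sum2 => // [rho||rho q].
  + exact: tensor_weight_gt0.
  + exact: tensor_weight_sum1.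
  + apply: (xline_admissible adm_convex gl_lobatto u_adm l q rho fhat1_pp) => //.
    * by move=> i' j' l' v ext /(lam_bound _ _ _ _ ext)[].
    * by rewrite divr_gt0.
- apply: convex_set_sum2 => // [rho||rho p].
  + exact: tensor_weight_gt0.
  + exact: tensor_weight_sum1.
  + apply: (yline_admissible adm_convex gl_lobatto u_adm l p rho fhat2_pp) => //.
    * by move=> i' j' l' v ext /(lam_bound _ _ _ _ ext)[].
    * by rewrite divr_gt0.
Qed.
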